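(* For all $C>0$ and all positive integers $k$ there is a constant $\delta=\delta(C,k)>0$ such that the following holds for every $n$. Let $\phi:\{0,1\}^n\to\{0,1\}^n$ be a mapping from $\mathrm{Dictator}$ to $\mathrm{XOR}$ which is $C$-Lipschitz and in which each output bit depends on at most $k$ input bits. Then the inverse map $\phi^{-1}$ is not $L$-Lipschitz for any $L<\delta\log n$.
   Context: For $x,y\in\{0,1\}^n$, $\mathrm{dist}(x,y)=\sum_i|x_i-y_i|$ is the Hamming distance. $\mathrm{Dictator}(x)=x_1$ and $\mathrm{XOR}(x)=\sum_{i=1}^n x_i \bmod 2$. For boolean functions $f,g:\{0,1\}^n\to\{0,1\}$, a mapping from $f$ to $g$ is a bijection $\phi:\{0,1\}^n\to\{0,1\}^n$ with $f(x)=g(\phi(x))$ for all $x$. A map $\psi$ is $C$-Lipschitz if $\mathrm{dist}(\psi(x),\psi(y))\le C\,\mathrm{dist}(x,y)$ for all $x,y$. Writing $\phi=(\phi_1,\dots,\phi_n)$, the output bit $\phi_j$ depends on input bit $i$ if there exists $x$ with $\phi_j(x)\ne\phi_j(x+e_i)$, where $e_i$ is the $i$th standard basis vector and addition is mod 2. *)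

(* Defs.v *)
From HB Require Import structures.
From mathcomp Require Import all_boot all_order all_algebra all_fingroup.
From mathcomp Require Import reals exp.

Set Implicit Arguments.
Unset Strict Implicit.
Unset Printing Implicit Defensive.

Import Order.TTheory GRing.Theory Num.Theory.

Local Open Scope ring_scope.

Definition cube (n : nat) := {ffun 'I_n -> bool}.

Definition hdist (n : nat) (x y : cube n) : nat :=
  (\sum_(i < n) (x i (+) y i))%N.

(* Coordinates are numbered from 0, so the first input bit is [x ord0]; the
   dimension is written [n.+1] because this bit exists only in dimension at
   least 1. *)
Definition dictator (n : nat) (x : cube n.+1) : bool := x ord0.

Definition xor (n : nat) (x : cube n) : bool := odd (\sum_(i < n) x i)%N.

(* [{perm cube n}] is the type of bijections of the (finite) cube, and
   [phi^-1] is the inverse bijection. *)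
Definition is_mapping (n : nat) (f g : cube n -> bool)
    (phi : {perm (cube n)}) : Prop :=
  forall x : cube n, f x = g (phi x).

Definition lipschitz (R : realType) (n : nat) (C : R)
    (psi : cube n -> cube n) : Prop :=
  forall x y : cube n, (hdist (psi x) (psi y))%:R <= C * (hdist x y)%:R.

(* x + e_i, with addition mod 2 *)
Definition flip (n : nat) (x : cube n) (i : 'I_n) : cube n :=
  [ffun j => x j (+) (j == i)].

Definition depends_on (n : nat) (psi : cube n -> cube n) (j i : 'I_n) : bool :=
  [exists x : cube n, psi x j != psi (flip x i) j].

Definition output_locality_le (n : nat) (psi : cube n -> cube n) (k : nat) :
    Prop :=
  forall j : 'I_n, (#|[set i | depends_on psi j i]| <= k)%N.

(* Main.v *)
Require Import Defs.
From HB Require Import structures.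
From mathcomp Require Import all_boot all_order all_algebra all_fingroup.
From mathcomp Require Import reals exp.

Set Implicit Arguments.
Unset Strict Implicit.
Unset Printing Implicit Defensive.

Import Order.TTheory GRing.Theory Num.Theory.

Local Open Scope ring_scope.

(** Joining an input bit to the output bits depending on it gives a bipartite
    graph.  An output bit that depends on input bit i, and on at most k input
    bits, is sensitive to i at a fraction at least 2^-k of the points of the
    cube; averaging the Lipschitz bound over the cube, at most C 2^k output
    bits depend on i, so the graph has bounded degree.  If the inverse is
    L-Lipschitz with L < delta log n, some output bit j lies further than
    about L steps from the first input bit.  Flipping j flips the parity of
    the output, hence changes a set S of at most L input bits containing the
    first one.  By pigeonhole S misses some sphere around the first bit, and
    applying only the changes inside that sphere does not change the output
    at all, which contradicts injectivity. *)

Lemma card_bigcup_le (I T : finType) (A : {set I}) (F : I -> {set T}) :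
  (#|\bigcup_(i in A) F i| <= \sum_(i in A) #|F i|)%N.
Proof.
elim/big_rec2: _ => [|i m B _ le]; first by rewrite cards0.
by apply: leq_trans (leq_card_setU _ _) _; rewrite leq_add2l.
Qed.

Section Dependence.
Variables (n : nat) (psi : cube n -> cube n).
Implicit Types (x y : cube n) (A : {set 'I_n}).

Definition deps j : {set 'I_n} := [set i | depends_on psi j i].
Definition outs A : {set 'I_n} := \bigcup_(i in A) [set j | depends_on psi j i].

(** Closed balls in the dependence graph. One unit of radius is a path input, output, input, so
    [ball i0 r] holds the inputs at graph distance at most 2r. *)
Fixpoint ball i0 r : {set 'I_n} :=
  if r is r'.+1 then
    ball i0 r' :|: \bigcup_(j in outs (ball i0 r')) deps j
  else [set i0].

Lemma hdist_card x y : hdist x y = #|[set i | x i != y i]|.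
Proof.
rewrite /hdist -sum1_card [RHS]big_mkcond /=; apply: eq_bigr => i _.
by rewrite inE; case: (x i); case: (y i).
Qed.

Lemma hdist_flip x i : hdist x (flip x i) = 1%N.
Proof.
rewrite hdist_card (_ : [set _ | _] = [set i]) ?cards1 //.
by apply/setP => j; rewrite !inE ffunE; case: (x j); case: (j == i).
Qed.

(** By induction on the distance: correct one bit where [x] and [y] differ; output [j] does not
    depend on it. *)
Lemma eq_on_deps j x y :
  (forall i, depends_on psi j i -> x i = y i) -> psi x j = psi y j.
Proof.
elim: {x}_.+1 {-2}x (ltnSn (hdist x y)) => // m IHm x.
rewrite ltnS => le_m eqxy.
have [/eqP nsub|[i]] := set_0Vmem [set i | x i != y i].
  congr (psi _ j); apply/ffunP => i; apply/eqP.
  by move/eqP/setP/(_ i): nsub; rewrite !inE => /negbFE.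
rewrite inE => neqi.
have flipi : flip x i i = y i.
  by rewrite ffunE eqxx; case: (x i) neqi; case: (y i).
have flipN l : l != i -> flip x i l = x l.
  by move=> /negbTE neq; rewrite ffunE neq addbF.
have -> : psi x j = psi (flip x i) j.
  apply/eqP/negPn/negP => neq; case/eqP: neqi; apply: eqxy.
  by apply/existsP; exists x.
apply: IHm => [|l dep]; last first.
  by have [->|/flipN->] := eqVneq l i; last exact: eqxy.
apply: leq_trans le_m; rewrite !hdist_card; apply: proper_card.
apply/properP; split; last by exists i; rewrite !inE ?flipi ?eqxx.
by apply/subsetP => l; rewrite !inE; have [->|/flipN->] := eqVneq l i.
Qed.

Lemma card_agree (J : {set 'I_n}) x0 :
  (#|{: cube n}| <= #|[set y : cube n | [forall i in J, y i == x0 i]]|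
                    * 2 ^ #|J|)%N.
Proof.
set A := [set y : cube n | _].
pose f y : cube n * {set 'I_n} :=
  ([ffun i => if i \in J then x0 i else y i], [set i in J | y i]).
rewrite -card_powerset -cardsX -cardsT -(card_in_imset (f := f)).
  apply/subset_leq_card/subsetP => _ /imsetP[y _ ->].
  rewrite !inE /=; apply/andP; split.
    by apply/forall_inP => i iJ; rewrite ffunE iJ.
  by apply/subsetP => i; rewrite inE => /andP[].
move=> y z _ _ [/ffunP eqF /setP eqT]; apply/ffunP => i.
by have := eqF i; have := eqT i; rewrite !ffunE !inE; case: (i \in J).
Qed.

(** The bits in [deps j] decide whether flipping [i] changes output [j], so one sensitive point
    makes a whole subcube of codimension at most [k] sensitive. *)
Lemma card_sensitive k j i : (#|deps j| <= k)%N -> depends_on psi j i ->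
  (#|{: cube n}|
     <= 2 ^ k * #|[set x : cube n | psi x j != psi (flip x i) j]|)%N.
Proof.
move=> le_k dep; have /existsP[x0 x0P] := dep.
apply: leq_trans (card_agree (deps j) x0) _; rewrite mulnC.
apply: leq_mul; first by rewrite leq_exp2l.
apply/subset_leq_card/subsetP => y; rewrite !inE => /forall_inP eqy.
have {}eqy l : depends_on psi j l -> y l = x0 l.
  by move=> dl; apply/eqP/eqy; rewrite inE.
have eqfl l : depends_on psi j l -> flip y i l = flip x0 i l.
  by move=> dl; rewrite !ffunE eqy.
by rewrite (eq_on_deps eqy) (eq_on_deps eqfl).
Qed.

Variables (c k : nat).
Hypothesis lip : forall x i, (hdist (psi x) (psi (flip x i)) <= c)%N.
Hypothesis loc : output_locality_le psi k.

Lemma card_dependent_outputs i :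
  (#|[set j | depends_on psi j i]| <= 2 ^ k * c)%N.
Proof.
have cube_gt0 : (0 < #|{: cube n}|)%N by apply/card_gt0P; exists [ffun=> false].
rewrite -(leq_pmul2r cube_gt0) -sum_nat_const -mulnA.
apply: (@leq_trans (\sum_j 2 ^ k *
    #|[set x : cube n | psi x j != psi (flip x i) j]|)%N).
  rewrite big_mkcond /=; apply: leq_sum => j _; rewrite inE.
  by case: ifP => // dep; apply: card_sensitive (loc j) dep.
rewrite -big_distrr leq_mul2l /=; apply/orP; right.
(* Double counting: for each fixed [x], flipping [i] changes at most [c] outputs. *)
under eq_bigr => j _ do rewrite -sum1_card big_mkcond /=.
rewrite exchange_big /= mulnC -sum_nat_const; apply: leq_sum => x _.
apply: leq_trans (lip x i); rewrite /hdist; apply: leq_sum => j _.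
by rewrite inE; case: (psi x j); case: (psi _ j).
Qed.

Lemma card_outs A : (#|outs A| <= #|A| * (2 ^ k * c))%N.
Proof.
rewrite -sum_nat_const; apply: leq_trans (card_bigcup_le _ _) _.
by apply: leq_sum => i _; apply: card_dependent_outputs.
Qed.

Lemma card_ball i0 r : (#|ball i0 r| <= (2 ^ k * c * k).+2 ^ r)%N.
Proof.
elim: r => [|r IHr] /=; first by rewrite cards1.
apply: leq_trans (leq_card_setU _ _) _.
have le_new : (#|\bigcup_(j in outs (ball i0 r)) deps j|
               <= #|ball i0 r| * (2 ^ k * c) * k)%N.
  apply: leq_trans (card_bigcup_le _ _) _.
  apply: (@leq_trans (\sum_(j in outs (ball i0 r)) k)%N).
    by apply: leq_sum => j _; apply: loc.
  by rewrite sum_nat_const leq_mul2r card_outs orbT.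
apply: leq_trans (leq_add (leqnn _) le_new) _.
rewrite -mulnA -mulnS expnSr; exact: leq_mul.
Qed.

Lemma card_outs_ball i0 r :
  (0 < k)%N -> (#|outs (ball i0 r)| <= (2 ^ k * c * k).+2 ^ r.+1)%N.
Proof.
move=> k_gt0; apply: leq_trans (card_outs _) _.
rewrite expnSr; apply: leq_mul; first exact: card_ball.
by apply: leq_trans (leq_pmulr _ k_gt0) _; rewrite leqW.
Qed.

End Dependence.

Section Pigeonhole.
Variables (n : nat) (psi : cube n -> cube n).
Hypothesis psi_inj : injective psi.
Implicit Types x y : cube n.

(* The point agreeing with [y] inside the ball and with [x] outside it has the
   same image as [x]. *)
Lemma sphere_meets_diff x y i0 j r :
    x i0 != y i0 -> (forall l, l != j -> psi x l = psi y l) ->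
    j \notin outs psi (ball psi i0 r) ->
  ~~ ([set i | x i != y i] :&: ball psi i0 r.+1
        \subset [set i | x i != y i] :&: ball psi i0 r).
Proof.
move=> neq0 eq_psi jN; apply/negP => /subsetP stable.
pose z : cube n := [ffun i => if i \in ball psi i0 r then y i else x i].
suff /psi_inj/ffunP/(_ i0) : psi z = psi x.
  have in0 : i0 \in ball psi i0 r.
    by elim: (r) => [|s IHs] /=; rewrite !inE ?IHs.
  by rewrite ffunE in0 => eq0; rewrite eq0 eqxx in neq0.
apply/ffunP => l; have [lO|lN] := boolP (l \in outs psi (ball psi i0 r)).
  (* Here [l] differs from [j], and [z] agrees with [y] on [deps l]: these bits lie in the next
     ball, where stability leaves no difference outside the smaller one. *)
  rewrite eq_psi; last by apply: contraNneq jN => <-.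
  apply: eq_on_deps => i dep; rewrite ffunE; case: ifP => // iN.
  apply/eqP/negPn/negP => neq.
  have := stable i; rewrite !inE neq iN /= => H; suff: false by []; apply: H.
  by apply/bigcupP; exists l => //; rewrite inE.
(* An output untouched by the ball sees only bits where [z] equals [x]. *)
apply: eq_on_deps => i dep; rewrite ffunE; case: ifP => // iB.
by case/negP: lN; apply/bigcupP; exists i => //; rewrite inE.
Qed.

Lemma outs_ball_mono i0 r s :
  (r <= s)%N -> outs psi (ball psi i0 r) \subset outs psi (ball psi i0 s).
Proof.
move/subnKC <-; elim: (s - r)%N => [|t IHt]; first by rewrite addn0.
apply: subset_trans IHt _; rewrite addnS /=.
apply/subsetP => l /bigcupP[i iB il]; apply/bigcupP; exists i => //.
by rewrite inE iB.
Qed.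

(** The difference set contains [i0] and gains an element at each of the [m.+1] increases of the
    radius. *)
Lemma hdist_far_flip x y i0 j m :
    x i0 != y i0 -> (forall l, l != j -> psi x l = psi y l) ->
    j \notin outs psi (ball psi i0 m) ->
  (m.+1 < hdist x y)%N.
Proof.
move=> neq0 eq_psi jN; rewrite hdist_card; set S := [set i | _].
suff grow r : (r <= m.+1)%N -> (r < #|S :&: ball psi i0 r|)%N.
  by apply: leq_trans (grow _ (leqnn _)) _; apply/subset_leq_card/subsetIl.
elim: r => [_|r IHr lt_r].
  by apply/card_gt0P; exists i0; rewrite !inE neq0 eqxx.
apply: leq_ltn_trans (IHr (ltnW lt_r)) _; apply: proper_card.
rewrite properE setIS /=; last exact: subsetUl.
apply: (sphere_meets_diff neq0 eq_psi).
by apply: contra jN; apply/subsetP/outs_ball_mono.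
Qed.

End Pigeonhole.

Lemma xor_flip n (x : cube n) i : xor (flip x i) = ~~ xor x.
Proof.
have xorE (y : cube n) : xor y = \big[addb/false]_l y l.
  rewrite /xor (big_morph odd oddD (erefl (odd 0))).
  by apply: eq_bigr => l _; rewrite oddb.
rewrite !xorE; under eq_bigr => l _ do rewrite ffunE.
rewrite big_split /= [X in _ (+) X](bigD1 i) //= eqxx.
rewrite [X in true (+) X]big1 ?addbT //.
by move=> l /negbTE.
Qed.

Theorem theorem1p1 (R : realType) (C : R) (k : nat) (C_gt0 : 0 < C)
    (k_gt0 : (0 < k)%N) :
  exists delta : R, 0 < delta /\
    forall (n : nat) (phi : {perm (cube n.+1)}),
      is_mapping (@dictator n) (@xor n.+1) phi ->
      lipschitz C phi ->
      output_locality_le phi k ->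
      forall L : R, L < delta * ln (n.+1)%:R -> ~ lipschitz L (phi^-1)%g.
Proof.
(* Distances are integers, so [C] may be rounded down. The [.+2] keeps [ln M] positive even if [c]
   is 0. *)
pose c := Num.truncn C; pose M := (2 ^ k * c * k).+2.
have lnM_gt0 : 0 < ln (M%:R : R) by rewrite ln_gt0 // ltr1n.
exists (ln M%:R)^-1; split=> [|n phi phi_map lipC loc L ltL lipL].
  by rewrite invr_gt0.
have lip x i : (hdist (phi x) (phi (flip x i)) <= c)%N.
  rewrite /c truncn_ge_nat; last exact: ltW.
  by have := lipC x (flip x i); rewrite hdist_flip mulr1.
pose pre j : cube n.+1 := (phi^-1)%g (flip (phi [ffun=> false]) j).
have pre_neq j : ([ffun=> false] : cube n.+1) ord0 != pre j ord0.
  have := phi_map [ffun=> false]; have := phi_map (pre j).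
  rewrite /dictator /pre permKV xor_flip => -> ->.
  by case: (xor _).
have pre_near j : (hdist [ffun=> false] (pre j))%:R <= L.
  have := lipL (phi [ffun=> false]) (flip (phi [ffun=> false]) j).
  by rewrite hdist_flip mulr1 permK.
have hdist_gt0 j : (0 < hdist [ffun=> false] (pre j))%N.
  by rewrite hdist_card; apply/card_gt0P; exists ord0; rewrite inE.
have L_ge0 : 0 <= L by apply: le_trans (pre_near ord0).
have pre_trunc j : (hdist [ffun=> false] (pre j) <= Num.truncn L)%N.
  by rewrite truncn_ge_nat.
(* This is what the choice of [delta] as 1 / ln M provides. *)
have ltM : (M ^ Num.truncn L < n.+1)%N.
  rewrite -(ltr_nat R) natrX -ltr_ln ?posrE ?exprn_gt0 ?ltr0n // lnXn ?ltr0n //.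
  rewrite mulrC ltr_pdivlMr // in ltL.
  apply: le_lt_trans ltL; rewrite -[leLHS]mulr_natl ler_wpM2r ?truncn_le //.
  exact: ltW.
(* The integer part of [L] is positive, since [pre j] differs from the zero point; write it [m.+1].
   Then the ball of radius [m] reaches fewer than [n.+1] outputs. *)
case: (Num.truncn L) pre_trunc ltM => [/(_ ord0)|m pre_trunc ltM].
  by rewrite leqNgt hdist_gt0.
have /subsetPn[j _ jN] : ~~ ([set: 'I_n.+1] \subset outs phi (ball phi ord0 m)).
  apply: contraL ltM => /subset_leq_card; rewrite cardsT card_ord -leqNgt => le.
  by apply: leq_trans le _; apply: card_outs_ball.
have := pre_trunc j; rewrite leqNgt => /negP; apply.
apply: (hdist_far_flip perm_inj (pre_neq j) _ jN) => l /negbTE neq.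
by rewrite /pre permKV [in RHS]ffunE neq addbF.
Qed.
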